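(* Let $X$ be a topological space, let the group of coefficients $G$ be a ring, and let $q\ge 0$. Then the integral, considered as a map $$\int\colon\check H^q(X)\times\check H_q(X)\to G,\qquad (z,\gamma)\mapsto\int_\gamma z,$$ is a bilinear form.
   Context: Let $\mathcal U$ be an open covering of $X$. Homology. A formal $q$-simplex is an ordered tuple $\sigma=(x_0\ \ldots\ x_q)$ of points of $X$ (repetitions allowed); it is $\mathcal U$-small if all $x_i$ lie in a common element of $\mathcal U$. The finite linear combinations, with coefficients in $G$, of $\mathcal U$-small formal $q$-simplices ($\mathcal U$-small $q$-chains) form $S^{\mathcal U}_q(X)$, with boundary $\partial(x_0\ \ldots\ x_q)=\sum_{j=0}^q(-1)^j(x_0\ \ldots\ \widehat{x_j}\ \ldots\ x_q)$. $H_q^{\mathcal U}(X)$ is the $q$-th homology of this complex. If $\mathcal V$ refines $\mathcal U$, inclusion of chains induces $H_q^{\mathcal V}(X)\to H_q^{\mathcal U}(X)$, and $\check H_q(X)=\varprojlim_{\mathcal U}H_q^{\mathcal U}(X)$ (Čech homology). An element $\gamma\in\check H_q(X)$ is a coherent family $(\gamma^{\mathcal U})_{\mathcal U}$; a $\mathcal U$-small representative of $\gamma$ is a $\mathcal U$-small cycle representing $\gamma^{\mathcal U}$. Cohomology. $C^q(X)$ is the set of all (not necessarily continuous) functions $\xi\colon X^{q+1}\to G$, called $q$-cochains, with coboundary $\delta\xi(x_0,\ldots,x_{q+1})=\sum_{j=0}^{q+1}(-1)^j\xi(x_0,\ldots,\widehat{x_j},\ldots,x_{q+1})$. A cochain is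 $\mathcal U$-locally zero if it vanishes on all tuples contained in a single member of $\mathcal U$; it is locally zero if this holds for some open covering. $\check H^q(X)$ is the Alexander--Spanier cohomology, i.e. the cohomology of $C^*(X)$ modulo locally zero cochains. Integral. For $z\in\check H^q(X)$ and $\gamma\in\check H_q(X)$, choose a cochain $\xi$ representing $z$, an open covering $\mathcal U$ such that $\delta\xi$ is $\mathcal U$-locally zero, and a $\mathcal U$-small representative $c=\sum_i k_i\sigma_i$ of $\gamma$. Then $\int_\gamma z:=\xi(c):=\sum_i k_i\,\xi(\sigma_i)$, where $\xi((x_0\ \ldots\ x_q))=\xi(x_0,\ldots,x_q)$; this is independent of the choices. *)

(* Defs.v *)
From HB Require Import structures.
From mathcomp Require Import all_boot all_order all_algebra.
From mathcomp Require Import finmap generic_quotient ring_quotient.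
From mathcomp Require Import boolp classical_sets functions cardinality fsbigop.
From mathcomp Require Import topology_structure.

Set Implicit Arguments.
Unset Strict Implicit.
Unset Printing Implicit Defensive.

Import GRing.Theory.

Local Open Scope classical_set_scope.
Local Open Scope ring_scope.
Local Open Scope quotient_scope.

Section QuotientModule.
Variables (R : pzRingType) (V : lmodType R) (S : submodClosed V).

Definition submod_pred : {pred V} := fun x => x \in S.

Fact submod_pred_zmod : zmod_closed submod_pred.
Proof.
have [S0 SD] := submodClosedP S; split=> [|x y]; rewrite !unfold_in //.
by move=> Sx Sy; rewrite addrC -scaleN1r; apply: SD.
Qed.
HB.instance Definition _ :=
  GRing.isZmodClosed.Build V submod_pred submod_pred_zmod.

Definition quotmod := Quotient.quot submod_pred.

HB.instance Definition _ := GRing.Zmodule.on quotmod.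

Definition qclass (x : V) : quotmod := \pi_quotmod x.

Lemma qclass_eq x y : (qclass x = qclass y) <-> (x - y \in S).
Proof.
rewrite (_ : (x - y \in S) = (x - y \in submod_pred)) // Quotient.idealrBE.
by split=> [/eqP|/eqP].
Qed.

Lemma qclassD : {morph qclass : x y / x + y}.
Proof. by move=> x y; rewrite /qclass /quotmod; exact: raddfD. Qed.

Lemma qclass_repr (u : quotmod) : qclass (repr u) = u.
Proof. exact: reprK. Qed.

Definition quot_scale (a : R) (u : quotmod) : quotmod := qclass (a *: repr u).

Lemma quot_scale_qclass a x : quot_scale a (qclass x) = qclass (a *: x).
Proof.
by apply/qclass_eq; rewrite -scalerBr rpredZ //; apply/qclass_eq/qclass_repr.
Qed.

Fact quot_scalerA a b u : quot_scale a (quot_scale b u) = quot_scale (a * b) u.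
Proof. by rewrite -(qclass_repr u) !quot_scale_qclass scalerA. Qed.

Fact quot_scale1r : left_id 1 quot_scale.
Proof. by move=> u; rewrite -(qclass_repr u) quot_scale_qclass scale1r. Qed.

Fact quot_scalerDr : right_distributive quot_scale +%R.
Proof.
move=> a u v; rewrite -(qclass_repr u) -(qclass_repr v).
by rewrite -qclassD !quot_scale_qclass scalerDr qclassD.
Qed.

Fact quot_scalerDl u : {morph quot_scale^~ u : a b / a + b}.
Proof.
by move=> a b; rewrite -(qclass_repr u) !quot_scale_qclass scalerDl qclassD.
Qed.

HB.instance Definition _ := GRing.Zmodule_isLmodule.Build R quotmod
  quot_scalerA quot_scale1r quot_scalerDr quot_scalerDl.

Lemma qclass_is_linear : linear qclass.
Proof. by move=> a x y; rewrite qclassD -quot_scale_qclass. Qed.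

HB.instance Definition _ :=
  GRing.isLinear.Build R V quotmod *:%R qclass qclass_is_linear.

End QuotientModule.
Arguments qclass {R V} S x.

Section QuotientMap.
Variables (R : pzRingType) (V W : lmodType R).
Variables (S : submodClosed V) (T : submodClosed W) (f : {linear V -> W}).

Definition quot_map (u : quotmod S) : quotmod T := qclass T (f (repr u)).

Hypothesis fST : forall x, x \in S -> f x \in T.

Lemma quot_map_qclass x : quot_map (qclass S x) = qclass T (f x).
Proof.
by apply/qclass_eq; rewrite -linearB; apply/fST/qclass_eq; rewrite qclass_repr.
Qed.

Lemma quot_map_linear : linear quot_map.
Proof.
move=> a u v; rewrite -(qclass_repr u) -(qclass_repr v) -linearP.
by rewrite !quot_map_qclass !linearP.
Qed.

End QuotientMap.
Arguments quot_map {R V W} S T f u.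

Section Homology.
Variables (R : pzRingType) (A B C : lmodType R).
Variables (f : {linear A -> B}) (g : {linear B -> C}).

Definition ker_pred : {pred B} := fun x => g x == 0.

Fact ker_submod : submod_closed ker_pred.
Proof.
split=> [|a x y]; rewrite !unfold_in ?raddf0 // => /eqP gx /eqP gy.
by rewrite linearP gx gy scaler0 addr0.
Qed.
HB.instance Definition _ := GRing.isSubmodClosed.Build R B ker_pred ker_submod.

Record hcycle := HCycle { cycle_val : B; _ : cycle_val \in ker_pred }.

HB.instance Definition _ := [isSub for cycle_val].
HB.instance Definition _ := [Choice of hcycle by <:].
HB.instance Definition _ := [SubChoice_isSubLmodule of hcycle by <:].

Definition boundary_pred : {pred hcycle} :=
  fun z => `[< exists a, f a = cycle_val z >].

Fact boundary_submod : submod_closed boundary_pred.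
Proof.
split=> [|a x y]; rewrite !unfold_in.
  by apply/asboolP; exists 0; rewrite raddf0.
move=> /asboolP[u fu] /asboolP[v fv]; apply/asboolP; exists (a *: u + v).
by rewrite linearP fu fv.
Qed.
HB.instance Definition _ :=
  GRing.isSubmodClosed.Build R hcycle boundary_pred boundary_submod.

(* Ker g / Im f for A -f-> B -g-> C; when g f = 0, boundary_pred is Im f seen
   inside Ker g. *)
Definition homology := quotmod boundary_pred.
HB.instance Definition _ := GRing.Lmodule.on homology.

Definition hclass (z : hcycle) : homology := qclass boundary_pred z.

Definition represents (x : B) (h : homology) : Prop :=
  exists2 z : hcycle, cycle_val z = x & hclass z = h.

End Homology.
Arguments boundary_pred {R A B C} f g.
Arguments hclass {R A B C f g} z.

Section HomologyMap.
Variables (R : pzRingType) (A B C A' B' C' : lmodType R).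
Variables (f : {linear A -> B}) (g : {linear B -> C}).
Variables (f' : {linear A' -> B'}) (g' : {linear B' -> C'}).
Variables (hA : {linear A -> A'}) (hB : {linear B -> B'}).
Variables (hC : {linear C -> C'}).
Hypothesis fh : forall a, f' (hA a) = hB (f a).
Hypothesis gh : forall b, g' (hB b) = hC (g b).

Fact cycle_map_subproof (z : hcycle g) : hB (cycle_val z) \in ker_pred g'.
Proof.
rewrite unfold_in gh; have := valP z; rewrite unfold_in => /eqP ->.
by rewrite raddf0.
Qed.
Definition cycle_map (z : hcycle g) : hcycle g' := HCycle (cycle_map_subproof z).

Fact cycle_map_is_linear : linear cycle_map.
Proof. by move=> a y z; apply: val_inj; rewrite /= linearP. Qed.
HB.instance Definition _ := GRing.isLinear.Build R (hcycle g) (hcycle g') *:%R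
  cycle_map cycle_map_is_linear.

Definition homology_map : homology f g -> homology f' g' :=
  quot_map (boundary_pred f g) (boundary_pred f' g') cycle_map.

Fact cycle_map_boundary z :
  z \in boundary_pred f g -> cycle_map z \in boundary_pred f' g'.
Proof.
rewrite !unfold_in => /asboolP[a fa]; apply/asboolP; exists (hA a).
by rewrite /= fh fa.
Qed.

Lemma homology_map_hclass z : homology_map (hclass z) = hclass (cycle_map z).
Proof. exact/quot_map_qclass/cycle_map_boundary. Qed.

Lemma homology_map_linear : linear homology_map.
Proof. exact/quot_map_linear/cycle_map_boundary. Qed.

End HomologyMap.
Arguments homology_map {R A B C A' B' C'} f {g} f' {g' hB hC} gh u.

Section FreeModule.
Variables (G : pzRingType) (K : choiceType).

Definition fin_supp : {pred K -> G^o} :=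
  fun c => `[< finite_set [set k | c k != 0] >].

Fact fin_supp_submod : submod_closed fin_supp.
Proof.
split=> [|a c d]; rewrite !unfold_in.
  apply/asboolP; rewrite [X in finite_set X](_ : _ = set0) //.
  by apply/seteqP; split=> k //=; rewrite eqxx.
move=> /asboolP fc /asboolP fd; apply/asboolP.
apply: (@sub_finite_set _ _ ([set k | c k != 0] `|` [set k | d k != 0])).
  move=> k /=; case: (eqVneq (c k) 0) => [ck|]; last by left.
  case: (eqVneq (d k) 0) => [dk|]; last by right.
  rewrite (_ : (a *: c + d) k = a *: c k + d k) // ck dk.
  by rewrite scaler0 addr0 eqxx.
by rewrite finite_setU.
Qed.
HB.instance Definition _ :=
  GRing.isSubmodClosed.Build G (K -> G^o) fin_supp fin_supp_submod.

(* The free left G-module on K, as finitely supported functions k |-> coefficient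
   of k. *)
Record freemod := Freemod { coef :> K -> G^o; _ : coef \in fin_supp }.

HB.instance Definition _ := [isSub for coef].
HB.instance Definition _ := [Choice of freemod by <:].
HB.instance Definition _ := [SubChoice_isSubLmodule of freemod by <:].

Lemma freemodP (c : freemod) : finite_set [set k | c k != 0].
Proof. by apply/asboolP; have := valP c; rewrite unfold_in. Qed.

Lemma coef_linear a (c d : freemod) k : (a *: c + d) k = a * c k + d k.
Proof. by []. Qed.

Fact gen_subproof (k : K) : (fun l => (l == k)%:R : G^o) \in fin_supp.
Proof.
rewrite unfold_in; apply/asboolP; apply: (@sub_finite_set _ _ [set k]) => //.
by move=> l /=; case: (eqVneq l k) => // _; rewrite eqxx.
Qed.
Definition gen (k : K) : freemod := Freemod (gen_subproof k).

Section Extend.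
Variables (M : lmodType G) (f : K -> M).

(* The support of c is finite, so this \sum_(_ \in _) is a finite sum. *)
Definition extend (c : freemod) : M := \sum_(k \in [set: K]) (c k : G) *: f k.

Lemma extend_is_linear : linear extend.
Proof.
move=> a c d; rewrite /extend.
pose s := [set k | c k != 0] `|` [set k | d k != 0].
have fs : finite_set s by rewrite finite_setU; split; exact: freemodP.
have sum_on (e : freemod) : [set k | e k != 0] `<=` s ->
  \sum_(k \in [set: K]) (e k : G) *: f k = \sum_(k \in s) (e k : G) *: f k.
  move=> es; rewrite -(@fsbig_widen _ _ _ _ s setT) // => k [_ /= nsk].
  case: (eqVneq (e k) 0) => [->|ek]; first by rewrite scale0r.
  by case: nsk; apply: es.
rewrite !sum_on.
- rewrite !fsbig_finite // scaler_sumr -big_split.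
  apply: eq_bigr => k _.
  by rewrite coef_linear scalerDl scalerA.
- by move=> k; right.
- by move=> k; left.
- move=> k; rewrite /mkset coef_linear.
  case: (eqVneq (c k) 0) => [ck|]; last by left.
  case: (eqVneq (d k) 0) => [dk|]; last by right.
  by rewrite ck dk mulr0 addr0 eqxx.
Qed.

HB.instance Definition _ :=
  GRing.isLinear.Build G freemod M *:%R extend extend_is_linear.

End Extend.

Lemma extend_on (M : lmodType G) (f : K -> M) (c : freemod) (s : set K) :
  finite_set s -> [set k | c k != 0] `<=` s ->
  extend f c = \sum_(k <- fset_set s) (c k : G) *: f k.
Proof.
move=> fs cs; rewrite /extend -(@fsbig_widen _ _ _ _ s setT) ?fsbig_finite //.
move=> k [_ /= nsk]; case: (eqVneq (c k) 0) => [->|ck]; first by rewrite scale0r.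
by case: nsk; apply: cs.
Qed.

Lemma extend_gen (M : lmodType G) (f : K -> M) k : extend f (gen k) = f k.
Proof.
rewrite (@extend_on _ _ _ [set k]) //.
  by rewrite fset_set1 big_seq_fset1 /= eqxx scale1r.
by move=> l /=; case: (eqVneq l k) => // _; rewrite eqxx.
Qed.

Lemma freemod_gen (c : freemod) : c = extend gen c.
Proof.
have fs := freemodP c.
apply: val_inj; apply/funext => l; rewrite (extend_on _ fs) //.
rewrite [RHS](_ : _ = \sum_(k <- fset_set [set k | c k != 0])
    (c k : G) * (l == k)%:R); last first.
  by elim/big_rec2: _ => // k x d _ <-; exact: coef_linear.
case: (eqVneq (c l) 0) => [cl|cl].
  rewrite [LHS]cl big1_seq // => k /andP[_ _].
  by case: (eqVneq l k) => [<-|]; rewrite ?mulr0 // cl mul0r.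
rewrite (bigD1_seq l) ?fset_uniq //=; last by rewrite in_fset_set // inE.
rewrite eqxx mulr1 big1 ?addr0 // => k kl.
by rewrite eq_sym (negPf kl) mulr0.
Qed.

Lemma linear_extend (M : lmodType G) (h : {linear freemod -> M}) c :
  h c = extend (h \o gen) c.
Proof.
rewrite {1}(freemod_gen c) !(extend_on _ (freemodP c)) // linear_sum.
by apply: eq_bigr => k _; rewrite linearZ.
Qed.

End FreeModule.
Arguments gen {G K} k.
Arguments extend {G K M} f c.

Record open_covering (X : topologicalType) := OpenCovering {
  members : set (set X);
  members_open : forall A, members A -> open A;
  members_cover : cover members id = [set: X]
}.

Definition refines (X : topologicalType) (V U : open_covering X) : Prop :=
  forall B, members V B -> exists2 A, members U A & B `<=` A.

(* (x_0 ... x_q) is encoded by i |-> x_i. *)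
Definition simplex (X : Type) (q : nat) := 'I_q.+1 -> X.

Definition face (X : Type) (q : nat) (j : 'I_q.+2) (s : simplex X q.+1) :
  simplex X q := s \o lift j.

Definition small (X : topologicalType) (U : open_covering X) q
    (s : simplex X q) : Prop :=
  exists2 A, members U A & forall i, A (s i).

Lemma small_face (X : topologicalType) (U : open_covering X) q j
  (s : simplex X q.+1) : small U s -> small U (face j s).
Proof. by move=> [A UA As]; exists A => // i; apply: As. Qed.

Lemma small_refines (X : topologicalType) (V U : open_covering X) q
  (s : simplex X q) : refines V U -> small V s -> small U s.
Proof.
by move=> VU [B VB Bs]; have [A UA BA] := VU B VB; exists A => // i; apply: BA.
Qed.

Section SmallSimplex.
Variables (X : topologicalType) (U : open_covering X) (q : nat).

Record small_simplex := SmallSimplex {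
  vertices : 'I_q.+1 -> X;
  vertices_small : `[< small U vertices >]
}.

HB.instance Definition _ := [isSub for vertices].
HB.instance Definition _ := [Choice of small_simplex by <:].

End SmallSimplex.

Definition small_face_simplex (X : topologicalType) (U : open_covering X) q
    (j : 'I_q.+2) (s : small_simplex U q.+1) : small_simplex U q :=
  SmallSimplex (asboolT (small_face j (asboolW (vertices_small s)))).

Definition refine_simplex (X : topologicalType) (V U : open_covering X) q
    (VU : refines V U) (s : small_simplex V q) : small_simplex U q :=
  SmallSimplex (asboolT (small_refines VU (asboolW (vertices_small s)))).

Section CechHomology.
Variables (G : pzRingType) (X : topologicalType).

(* The free module on the set of U-small simplices; G need not be commutative,
   and acts on chains on the left. *)
Definition chain (U : open_covering X) (q : nat) := freemod G (small_simplex U q).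
HB.instance Definition _ U q := GRing.Lmodule.on (chain U q).

Definition boundary U q : chain U q.+1 -> chain U q :=
  extend (fun s => \sum_(j < q.+2) (-1) ^+ j *: gen (small_face_simplex j s)).
HB.instance Definition _ U q := GRing.Linear.on (@boundary U q).

(* The boundary out of degree q; the chain group in degree -1 is 0, so the
   boundary out of degree 0 is the zero map. *)
Definition boundary_out U q : chain U q -> chain U q.-1 :=
  match q with 0 => fun=> 0 | p.+1 => @boundary U p end.

Fact boundary_out_linear U q : linear (@boundary_out U q).
Proof.
case: q => [|q] a x y /=; first by rewrite scaler0 addr0.
exact: linearP.
Qed.
HB.instance Definition _ U q := GRing.isLinear.Build G (chain U q)
  (chain U q.-1) *:%R (@boundary_out U q) (@boundary_out_linear U q).

Definition small_homology U q := homology (@boundary U q) (@boundary_out U q).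
HB.instance Definition _ U q := GRing.Lmodule.on (small_homology U q).

Section Refinement.
Variables (V U : open_covering X) (VU : refines V U).

Definition refine_chain q : chain V q -> chain U q :=
  extend (fun s => gen (refine_simplex VU s)).
HB.instance Definition _ q := GRing.Linear.on (@refine_chain q).

Lemma boundary_refine q (c : chain V q.+1) :
  boundary (refine_chain c) = refine_chain (boundary c).
Proof.
pose bdr : {linear _ -> _} := @boundary U q \o @refine_chain q.+1.
pose rb : {linear _ -> _} := @refine_chain q \o @boundary V q.
rewrite -[LHS]/(bdr c) -[RHS]/(rb c) (linear_extend bdr) (linear_extend rb).
congr (extend _ c); apply/funext => s /=.
rewrite /boundary /refine_chain !extend_gen linear_sum /=.
by apply: eq_bigr => j _; rewrite linearZ /= extend_gen; congr (_ *: gen _);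
  exact: val_inj.
Qed.

Lemma boundary_out_refine q (c : chain V q) :
  boundary_out (refine_chain c) = refine_chain (boundary_out c).
Proof. by case: q c => [|q] c /=; rewrite ?raddf0 // boundary_refine. Qed.

Definition refine_homology q : small_homology V q -> small_homology U q :=
  homology_map (@boundary V q) (@boundary U q) (@boundary_out_refine q).

Lemma refine_homology_linear q : linear (@refine_homology q).
Proof. exact/homology_map_linear/boundary_refine. Qed.

End Refinement.

(* The inverse limit over all open coverings, with componentwise operations. *)
Record cech_homology (q : nat) := CechHomology {
  cech_component : forall U : open_covering X, small_homology U q;
  cech_coherent : forall (V U : open_covering X) (VU : refines V U),
    refine_homology VU (cech_component V) = cech_component U
}.

HB.instance Definition _ q := gen_eqMixin (cech_homology q).
HB.instance Definition _ q := gen_choiceMixin (cech_homology q).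

Lemma cech_homologyP q (a b : cech_homology q) :
  (forall U, cech_component a U = cech_component b U) -> a = b.
Proof.
case: a b => [a ca] [b cb] /= ab; have {}ab : a = b by exact: functional_extensionality_dep.
by case: _ / ab cb => cb; congr CechHomology; exact: Prop_irrelevance.
Qed.

Section CechModule.
Variable q : nat.
Implicit Types a b c : cech_homology q.

Fact cech_lin_coherent k a b V U (VU : refines V U) :
  refine_homology VU (k *: cech_component a V + cech_component b V) =
  k *: cech_component a U + cech_component b U.
Proof. by rewrite refine_homology_linear !cech_coherent. Qed.

Fact cech_zero_coherent V U (VU : refines V U) : @refine_homology V U VU q 0 = 0.
Proof.
have := refine_homology_linear VU (-1) 0 (0 : small_homology V q).
by rewrite scaler0 addr0 scaleN1r addNr.
Qed.

Definition cech_zero := CechHomology cech_zero_coherent.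

Definition cech_lin k a b := CechHomology (cech_lin_coherent k a b).

Definition cech_add a b := cech_lin 1 a b.
Definition cech_scale k a := cech_lin k a cech_zero.
Definition cech_opp a := cech_scale (-1) a.

Fact cech_addA : associative cech_add.
Proof. by move=> a b c; apply: cech_homologyP => U /=; rewrite !scale1r addrA. Qed.
Fact cech_addC : commutative cech_add.
Proof. by move=> a b; apply: cech_homologyP => U /=; rewrite !scale1r addrC. Qed.
Fact cech_add0 : left_id cech_zero cech_add.
Proof. by move=> a; apply: cech_homologyP => U /=; rewrite scale1r add0r. Qed.
Fact cech_addN : left_inverse cech_zero cech_opp cech_add.
Proof.
by move=> a; apply: cech_homologyP => U /=; rewrite scale1r scaleN1r addr0 addNr.
Qed.
HB.instance Definition _ := GRing.isZmodule.Build (cech_homology q)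
  cech_addA cech_addC cech_add0 cech_addN.

Fact cech_scaleA k l a : cech_scale k (cech_scale l a) = cech_scale (k * l) a.
Proof. by apply: cech_homologyP => U /=; rewrite !addr0 scalerA. Qed.
Fact cech_scale1 : left_id 1 cech_scale.
Proof. by move=> a; apply: cech_homologyP => U /=; rewrite addr0 scale1r. Qed.
Fact cech_scaleDr : right_distributive cech_scale +%R.
Proof.
move=> k a b; apply: cech_homologyP => U /=.
by rewrite !scale1r !addr0 scalerDr.
Qed.
Fact cech_scaleDl a : {morph cech_scale^~ a : k l / k + l}.
Proof.
by move=> k l; apply: cech_homologyP => U /=; rewrite scale1r !addr0 scalerDl.
Qed.
HB.instance Definition _ := GRing.Zmodule_isLmodule.Build G (cech_homology q)
  cech_scaleA cech_scale1 cech_scaleDr cech_scaleDl.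

End CechModule.
End CechHomology.

Section AlexanderSpanier.
Variables (G : pzRingType) (X : topologicalType).

(* G acts on cochains on the right, a : G^c sending xi to s |-> xi(s) a: right
   G-modules are left modules over the converse ring G^c. This is what makes
   xi |-> xi(c) linear when G is not commutative; for commutative G it is the
   usual action. *)
Definition cochain (q : nat) := simplex X q -> G^c^o.
HB.instance Definition _ q := GRing.Lmodule.on (cochain q).

Definition coboundary q (xi : cochain q) : cochain q.+1 :=
  fun s => \sum_(j < q.+2) (-1) ^+ j * (xi (face j s) : G).

Fact coboundary_is_linear q : linear (@coboundary q).
Proof.
move=> a xi eta; apply/funext => s.
have lin (x y : 'I_q.+2 -> G) (b : G) :
    \sum_(j < q.+2) (-1) ^+ j * (x j * b + y j) =
    (\sum_(j < q.+2) (-1) ^+ j * x j) * b + \sum_(j < q.+2) (-1) ^+ j * y j.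
  rewrite mulr_suml -big_split; apply: eq_bigr => j _.
  by rewrite mulrDr mulrA.
exact: (lin (fun j => xi (face j s)) (fun j => eta (face j s)) a).
Qed.
HB.instance Definition _ q := GRing.isLinear.Build G^c (cochain q)
  (cochain q.+1) *:%R (@coboundary q) (@coboundary_is_linear q).

Definition locally_zero_on (U : open_covering X) q (xi : cochain q) : Prop :=
  forall s, small U s -> xi s = 0.

Definition locally_zero q : {pred cochain q} :=
  fun xi => `[< exists U, locally_zero_on U xi >].

Lemma exists_covering : exists U : open_covering X, True.
Proof.
have To (A : set X) : [set [set: X]] A -> open A by move=> ->; exact: openT.
have Tc : cover [set [set: X]] id = [set: X] by exact: bigcup_set1.
by exists (OpenCovering To Tc).
Qed.

Lemma common_refinement (U V : open_covering X) :
  exists W : open_covering X, refines W U /\ refines W V.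
Proof.
have Wo A : [set A `&` B | A in members U & B in members V] A -> open A.
  by move=> [B UB] [C VC] <-; apply: openI; [exact: (members_open UB)|exact: (members_open VC)].
have Wc : cover [set A `&` B | A in members U & B in members V] id = [set: X].
  apply/seteqP; split=> // x _.
  have [B UB Bx] : cover (members U) id x by rewrite members_cover.
  have [C VC Cx] : cover (members V) id x by rewrite members_cover.
  by exists (B `&` C) => //; exists B => //; exists C.
exists (OpenCovering Wo Wc); split=> _ [A UA [B VB <-]].
  by exists A => //; exact: subIsetl.
by exists B => //; exact: subIsetr.
Qed.

Fact locally_zero_submod q : submod_closed (@locally_zero q).
Proof.
split=> [|a xi eta]; rewrite !unfold_in.
  by have [U _] := exists_covering; apply/asboolP; exists U.
move=> /asboolP[U xi0] /asboolP[V eta0]; apply/asboolP.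
have [W [WU WV]] := common_refinement U V; exists W => s Ws.
have xis : xi s = 0 by apply: xi0; exact: small_refines WU Ws.
have etas : eta s = 0 by apply: eta0; exact: small_refines WV Ws.
transitivity (a *: (xi s : G^c^o) + eta s) => //.
by rewrite xis etas scaler0 addr0.
Qed.
HB.instance Definition _ q :=
  GRing.isSubmodClosed.Build G^c (cochain q) (@locally_zero q)
    (@locally_zero_submod q).

Definition as_cochain q := quotmod (@locally_zero q).
HB.instance Definition _ q := GRing.Lmodule.on (as_cochain q).

Fact coboundary_locally_zero q (xi : cochain q) :
  xi \in @locally_zero q -> coboundary xi \in @locally_zero q.+1.
Proof.
rewrite !unfold_in => /asboolP[U xi0]; apply/asboolP; exists U => s Us.
rewrite /coboundary big1 // => j _; rewrite xi0 ?mulr0 //.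
exact: small_face.
Qed.

Definition as_coboundary q : as_cochain q -> as_cochain q.+1 :=
  quot_map (@locally_zero q) (@locally_zero q.+1) (@coboundary q).

Fact as_coboundary_is_linear q : linear (@as_coboundary q).
Proof. exact/quot_map_linear/coboundary_locally_zero. Qed.
HB.instance Definition _ q := GRing.isLinear.Build G^c (as_cochain q)
  (as_cochain q.+1) *:%R (@as_coboundary q) (@as_coboundary_is_linear q).

(* The coboundary into degree q; C^{-1} = 0, so it is the zero map if q = 0. *)
Definition as_coboundary_in q : as_cochain q.-1 -> as_cochain q :=
  match q with 0 => fun=> 0 | p.+1 => @as_coboundary p end.

Fact as_coboundary_in_is_linear q : linear (@as_coboundary_in q).
Proof.
case: q => [|q] a x y /=; first by rewrite scaler0 addr0.
exact: linearP.
Qed.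
HB.instance Definition _ q := GRing.isLinear.Build G^c (as_cochain q.-1)
  (as_cochain q) *:%R (@as_coboundary_in q) (@as_coboundary_in_is_linear q).

Definition as_cohomology q := homology (@as_coboundary_in q) (@as_coboundary q).
HB.instance Definition _ q := GRing.Lmodule.on (as_cohomology q).

Definition cochain_represents q (xi : cochain q) (z : as_cohomology q) : Prop :=
  represents (qclass (@locally_zero q) xi) z.

End AlexanderSpanier.

Section Integral.
Variables (G : pzRingType) (X : topologicalType) (q : nat).

Definition small_representative (U : open_covering X) (c : chain G U q)
    (gamma : cech_homology G X q) : Prop :=
  represents c (cech_component gamma U).

(* xi(c) = sum_i k_i xi(sigma_i); c has finite support. *)
Definition eval_chain (U : open_covering X) (xi : cochain G X q)
    (c : chain G U q) : G :=
  \sum_(s \in [set: small_simplex U q]) (c s : G) * (xi (vertices s) : G).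

Definition integral_values (z : as_cohomology G X q)
    (gamma : cech_homology G X q) : set G :=
  [set a | exists (xi : cochain G X q) (U : open_covering X) (c : chain G U q),
    [/\ cochain_represents xi z, locally_zero_on U (coboundary xi),
        small_representative c gamma & a = eval_chain xi c]].

(* xget selects an element of the set of values obtained from all admissible
   choices of xi, U and c; this set is a singleton, so the default 0 is never
   used. *)
Definition integral (z : as_cohomology G X q) (gamma : cech_homology G X q) : G :=
  xget 0 (integral_values z gamma).

End Integral.

(* Main.v *)
Require Import Defs.
From HB Require Import structures.
From mathcomp Require Import all_boot all_order all_algebra.
From mathcomp Require Import boolp classical_sets topology_structure.

Set Implicit Arguments.
Unset Strict Implicit.
Unset Printing Implicit Defensive.

Import GRing.Theory.
Local Open Scope ring_scope.

(** Evaluation [eval_chain xi c] is linear in the chain and in the cochain, so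
    the integral is bilinear as soon as its value does not depend on the
    choices of cochain, covering and small cycle: representatives of z and z'
    (or of gamma and gamma') can then be taken over one covering and combined
    linearly. All lies in the independence, whose engine is Stokes' formula
    [eval_coboundary]: xi(boundary c) = (coboundary xi)(c).

    If [coboundary xi] vanishes on U-small simplices, then xi takes the same
    value on two U-small cycles that differ by the boundary of a U-small chain.
    As refining a chain changes neither its value nor the homology class it
    stands for, a finer representative of gamma gives the same value
    ([eval_finer_representative]).

    If xi and eta represent the same class z, then xi - eta is a coboundary up
    to a locally zero cochain; on cycles of a fine enough covering the latter
    does not count, and the former vanishes by Stokes' formula
    ([eval_cohomologous]). Given two sets of choices, a covering fine enough
    for both links their values ([integral_eq]). *)

Section Represents.
Variables (R : pzRingType) (A B C : lmodType R).
Variables (f : {linear A -> B}) (g : {linear B -> C}).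
Implicit Types (x y : B) (h k : homology f g).

Lemma represents_linear a x y h k :
  represents x h -> represents y k -> represents (a *: x + y) (a *: h + k).
Proof.
move=> [u <- <-] [v <- <-]; exists (a *: u + v) => //.
exact: linearP (qclass (boundary_pred f g)) a u v.
Qed.

Lemma represents_exists h : exists x, represents x h.
Proof.
by exists (cycle_val (generic_quotient.repr h)), (generic_quotient.repr h);
  rewrite // /hclass qclass_repr.
Qed.

Lemma represents_cycle x h : represents x h -> g x = 0.
Proof. by move=> [u <- _]; have := valP u; rewrite unfold_in => /eqP. Qed.

Lemma represents_homologous x y h :
  represents x h -> represents y h -> exists a, f a = x - y.
Proof.
move=> [u <- <-] [v <-] /esym /qclass_eq.
by rewrite unfold_in => /asboolP.
Qed.

End Represents.

Lemma linear_ext (R : pzRingType) (K : choiceType) (M : lmodType R)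
    (h1 h2 : {linear freemod R K -> M}) :
  (forall k, h1 (gen k) = h2 (gen k)) -> h1 =1 h2.
Proof.
move=> h12 c; rewrite (linear_extend h1) (linear_extend h2).
by congr (extend _ c); apply/funext.
Qed.

Section Evaluation.
Variables (G : pzRingType) (X : topologicalType).
Implicit Types U V W : open_covering X.

Lemma eval_chainE U q (xi : cochain G X q) (c : chain G U q) :
  eval_chain xi c = extend (fun s => xi (vertices s) : G^o) c.
Proof. by []. Qed.

Lemma eval_chain_linearr U q (xi : cochain G X q) a (c d : chain G U q) :
  eval_chain xi (a *: c + d) = a * eval_chain xi c + eval_chain xi d.
Proof. by rewrite !eval_chainE linearP. Qed.

(** Cochains are scaled on the right, whence the side of [a]. *)
Lemma eval_chain_linearl U q a (xi eta : cochain G X q) (c : chain G U q) :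
  eval_chain ((a : G^c) *: xi + eta) c =
  eval_chain xi c * (a : G) + eval_chain eta c.
Proof.
rewrite !eval_chainE !(extend_on _ (freemodP c)) // mulr_suml -big_split.
apply: eq_bigr => s _ /=.
rewrite -[RHS]/((c s : G) * xi (vertices s) * a + (c s : G) * eta (vertices s)).
by rewrite -mulrA -mulrDr.
Qed.

Lemma eval_chainD U q (xi eta : cochain G X q) (c : chain G U q) :
  eval_chain (xi + eta) c = eval_chain xi c + eval_chain eta c.
Proof. by rewrite -[xi]scale1r eval_chain_linearl mulr1 scale1r. Qed.

Lemma eval_locally_zero U q (xi : cochain G X q) (c : chain G U q) :
  locally_zero_on U xi -> eval_chain xi c = 0.
Proof.
move=> xi0; rewrite eval_chainE (extend_on _ (freemodP c)) //.
rewrite big1 // => s _; rewrite xi0 ?scaler0 //.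
exact: asboolW (vertices_small s).
Qed.

Lemma eval_coboundary U q (xi : cochain G X q) (c : chain G U q.+1) :
  eval_chain (coboundary xi) c = eval_chain xi (boundary c).
Proof.
pose ev : {linear chain G U q -> G^o} := extend (fun s => xi (vertices s) : G^o).
pose evd : {linear chain G U q.+1 -> G^o} :=
  extend (fun s => coboundary xi (vertices s) : G^o).
pose evb : {linear chain G U q.+1 -> G^o} := ev \o @boundary G X U q.
apply: (linear_ext (h1 := evd) (h2 := evb)) => s.
rewrite /evd /evb /ev /= /boundary !extend_gen linear_sum.
by apply: eq_bigr => j _; rewrite linearZ /= extend_gen.
Qed.

Lemma eval_refine V U (VU : refines V U) q (xi : cochain G X q)
    (c : chain G V q) :
  eval_chain xi (refine_chain VU c) = eval_chain xi c.
Proof.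
pose ev W : {linear chain G W q -> G^o} := extend (fun s => xi (vertices s) : G^o).
pose evr : {linear chain G V q -> G^o} := ev U \o @refine_chain G X V U VU q.
apply: (linear_ext (h1 := evr) (h2 := ev V)) => s.
by rewrite /evr /ev /= /refine_chain !extend_gen.
Qed.

Lemma locally_zero_on_refines V U q (xi : cochain G X q) :
  refines V U -> locally_zero_on U xi -> locally_zero_on V xi.
Proof. by move=> VU xi0 s Vs; apply: xi0; exact: small_refines VU Vs. Qed.

Lemma refine_representative V U (VU : refines V U) q (c : chain G V q)
    (gamma : cech_homology G X q) :
  small_representative c gamma -> small_representative (refine_chain VU c) gamma.
Proof.
move=> [u <- uh]; exists (Defs.cycle_map (@boundary_out_refine G X V U VU q) u) => //.
rewrite -(cech_coherent gamma VU) -uh; apply/esym.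
exact/homology_map_hclass/boundary_refine.
Qed.

Lemma eval_finer_representative V U (VU : refines V U) q (xi : cochain G X q)
    (c : chain G U q) (d : chain G V q) (gamma : cech_homology G X q) :
  locally_zero_on U (coboundary xi) ->
  small_representative c gamma -> small_representative d gamma ->
  eval_chain xi c = eval_chain xi d.
Proof.
move=> dxi0 cg /(refine_representative VU) dg.
have [b bE] := represents_homologous cg dg.
rewrite -(eval_refine VU) -[c](subrK (refine_chain VU d)) -bE.
rewrite -[X in eval_chain _ (X + _)]scale1r eval_chain_linearr mul1r.
by rewrite -eval_coboundary eval_locally_zero // add0r.
Qed.

(** A single covering serves all chains because two representatives of z differ
    by a coboundary up to one locally zero cochain. *)
Lemma eval_cohomologous q (xi eta : cochain G X q) (z : as_cohomology G X q) :
  cochain_represents xi z -> cochain_represents eta z ->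
  exists V, forall W (c : chain G W q), refines W V -> boundary_out c = 0 ->
    eval_chain xi c = eval_chain eta c.
Proof.
move=> xiz etaz; have [w wE] := represents_homologous xiz etaz.
(* theta is the exact part of xi - eta: a coboundary, which in degree 0 is 0. *)
suff [theta [xi_eta theta0]] : exists theta : cochain G X q,
    qclass (@locally_zero G X q) xi - qclass (@locally_zero G X q) eta =
    qclass (@locally_zero G X q) theta /\
    forall W (c : chain G W q), boundary_out c = 0 -> eval_chain theta c = 0.
  have : xi - (theta + eta) \in @locally_zero G X q.
    by apply/qclass_eq; rewrite qclassD -xi_eta subrK.
  rewrite unfold_in => /asboolP[V V0]; exists V => W c WV dc.
  rewrite -[xi](subrK (theta + eta)) eval_chainD.
  rewrite (eval_locally_zero c (locally_zero_on_refines WV V0)) add0r.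
  by rewrite eval_chainD theta0 // add0r.
case: q xi eta z xiz etaz w wE => [|q] xi eta z xiz etaz w /= wE.
  exists 0; split; first by rewrite -wE linear0.
  by move=> W c _; apply: eval_locally_zero.
exists (coboundary (generic_quotient.repr w)); split; first by rewrite -wE.
move=> W c dc; rewrite eval_coboundary [boundary c]dc.
by rewrite eval_chainE linear0.
Qed.

Lemma cocycle_representative q (z : as_cohomology G X q) :
  exists xi U, cochain_represents xi z /\ locally_zero_on U (coboundary xi).
Proof.
have [x xz] := represents_exists z.
pose xi : cochain G X q := generic_quotient.repr x.
have xE : qclass (@locally_zero G X q) xi = x by exact: qclass_repr.
have : coboundary xi - 0 \in @locally_zero G X q.+1.
  apply/qclass_eq; rewrite linear0 -(represents_cycle xz) -[in RHS]xE.
  by apply/esym/quot_map_qclass; exact: coboundary_locally_zero.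
rewrite subr0 unfold_in => /asboolP[U U0].
by exists xi, U; rewrite /cochain_represents xE.
Qed.

Lemma integral_eq q (z : as_cohomology G X q) (gamma : cech_homology G X q)
    (xi : cochain G X q) U (c : chain G U q) :
  cochain_represents xi z -> locally_zero_on U (coboundary xi) ->
  small_representative c gamma -> integral z gamma = eval_chain xi c.
Proof.
move=> xiz U0 cg; rewrite /integral; apply: xget_unique.
  by exists xi, U, c.
move=> _ [eta [U' [c' [etaz U'0 c'g ->]]]].
have [V Veq] := eval_cohomologous etaz xiz.
have [W1 [W1U W1U']] := common_refinement U U'.
have [W [WW1 WV]] := common_refinement W1 V.
have WU : refines W U.
  move=> A /WW1[B /W1U[D UD BD] AB]; exists D => //.
  exact: subset_trans BD.
have WU' : refines W U'.
  move=> A /WW1[B /W1U'[D UD BD] AB]; exists D => //.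
  exact: subset_trans BD.
have [d dg] := represents_exists (cech_component gamma W).
rewrite (eval_finer_representative WU U0 cg dg).
rewrite (eval_finer_representative WU' U'0 c'g dg).
exact: Veq WV (represents_cycle dg).
Qed.

Lemma cech_component_linear q a (gamma gamma' : cech_homology G X q) U :
  cech_component (a *: gamma + gamma') U =
  a *: cech_component gamma U + cech_component gamma' U.
Proof.
rewrite -[LHS]/(1 *: (a *: cech_component gamma U + 0) + cech_component gamma' U).
by rewrite scale1r addr0.
Qed.

End Evaluation.

Theorem proposition15 (G : pzRingType) (X : topologicalType) (q : nat) :
  (forall gamma : cech_homology G X q,
     GRing.linear_for (fun (a : G^c) (x : G) => x * (a : G))
       (fun z : as_cohomology G X q => integral z gamma)) /\
  (forall z : as_cohomology G X q,
     GRing.linear_for (fun (a : G) (x : G) => a * x)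
       (fun gamma : cech_homology G X q => integral z gamma)).
Proof.
split=> [gamma a z z'|z a gamma gamma'].
  have [xi [U [xiz U0]]] := cocycle_representative z.
  have [eta [V [etaz V0]]] := cocycle_representative z'.
  have [W [WU WV]] := common_refinement U V.
  have [c cg] := represents_exists (cech_component gamma W).
  have xiW := locally_zero_on_refines WU U0.
  have etaW := locally_zero_on_refines WV V0.
  rewrite (integral_eq xiz xiW cg) (integral_eq etaz etaW cg).
  rewrite -eval_chain_linearl; apply: integral_eq cg.
    rewrite /cochain_represents linearP.
    exact: represents_linear.
  move=> s Ws; rewrite linearP.
  rewrite -[LHS]/((a : G^c) *: (coboundary xi s : G^c^o) + coboundary eta s).
  by rewrite xiW // etaW // scaler0 addr0.
have [xi [U [xiz U0]]] := cocycle_representative z.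
have [c cg] := represents_exists (cech_component gamma U).
have [d dg] := represents_exists (cech_component gamma' U).
rewrite (integral_eq xiz U0 cg) (integral_eq xiz U0 dg).
rewrite -eval_chain_linearr; apply: (integral_eq xiz U0).
rewrite /small_representative cech_component_linear.
exact: represents_linear.
Qed.
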